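(* Let $p(\cdot):\mathbb{N}\to[1,\infty)$ be an exponent function and suppose that $S_{p(\cdot)}$ is dense in $\ell^{p(\cdot)}$. Then $(\ell^{p(\cdot)})^*$ is isomorphic to the external direct sum $$\ell^{p'(\cdot)}\oplus pba_\omega(\mathcal{M}_{p(\cdot)}).$$
   Context: Sequences are real. For $q(\cdot):\mathbb{N}\to[1,\infty]$, with $N_\infty=\{k:q(k)=\infty\}$, the modular is $\rho_{q(\cdot)}(x)=\sum_{k\notin N_\infty}|x(k)|^{q(k)}+\sup_{k\in N_\infty}|x(k)|$, and $\ell^{q(\cdot)}$ is the Banach space of sequences $x$ with $\rho_{q(\cdot)}(x/\lambda)<\infty$ for some $\lambda>0$, normed by $\|x\|_{\ell^{q(\cdot)}}=\inf\{\lambda>0:\rho_{q(\cdot)}(x/\lambda)\le1\}$. The dual exponent is given by $1/p(k)+1/p'(k)=1$, with $1/\infty=0$. Let $\ell^{p(\cdot)}_b$ be the set of $x\in\ell^{p(\cdot)}$ with $p$ bounded on $\operatorname{supp}(x)=\{k:x(k)\neq0\}$, and let $\ell^{p(\cdot)}_{\mathrm{germ}}=\ell^{p(\cdot)}/\overline{\ell^{p(\cdot)}_b}$ with the quotient norm; $[x]$ is the class of $x$. A set $A\subseteq\mathbb{N}$ has finite $p(\cdot)$-content if there is $B>1$ with $\sum_{k\in A}B^{-p(k)}<\infty$; $\mathcal{M}_{p(\cdot)}$ is the collection of all such sets. For $A\in\mathcal{M}_{p(\cdot)}$ put $\omega(A)=\|[\mathbf 1_A]\|_{\ell^{p(\cdot)}_{\mathrm{germ}}}$.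 Let $S_{p(\cdot)}$ be the set of all finite sums $\sum_{k=1}^N\alpha_k\mathbf 1_{A_k}$ with $\alpha_k\in\mathbb{R}$ and $A_k\in\mathcal{M}_{p(\cdot)}$ pairwise disjoint. $pba_\omega(\mathcal{M}_{p(\cdot)})$ is the vector space of set functions $\mu:\mathcal{M}_{p(\cdot)}\to\mathbb{R}$ such that (1) $\mu(A\cup B)=\mu(A)+\mu(B)$ for all disjoint $A,B\in\mathcal{M}_{p(\cdot)}$, and (2) there is $C>0$ such that $\sum_{i=1}^n\frac{|\mu(A_i)|}{\omega(A_i)}\le C$ for every finite collection of pairwise disjoint $A_1,\dots,A_n\in\mathcal{M}_{p(\cdot)}$, with the conventions $0/0=0$ and $c/0=\infty$ for $c>0$ (so $\mu(A)=0$ whenever $\omega(A)=0$, in particular for finite $A$). Its norm is the infimum of the $C>0$ for which (2) holds. ''Isomorphic'' means there is a bounded linear bijection with bounded inverse. *)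

(* Defs.v *)
From HB Require Import structures.
From mathcomp Require Import all_boot all_order all_algebra.
From mathcomp Require Import all_classical all_reals all_analysis.

Set Implicit Arguments.
Unset Strict Implicit.
Unset Printing Implicit Defensive.

Import Order.TTheory GRing.Theory Num.Theory.
Import numFieldNormedType.Exports.

Local Open Scope classical_set_scope.
Local Open Scope ring_scope.

(* Norm axioms for x |-> inf {c | P x c}; all the norms below are of this form. *)
Section inf_norm.
Context {R : realType} {V : lmodType R} (P : V -> R -> Prop).
Context (P_gt0 : forall x c, P x c -> 0 < c).
Context (P_ex : forall x, exists c, P x c).
Context (P_0 : forall c, 0 < c -> P 0 c).
Context (P_D : forall x y c d, P x c -> P y d -> P (x + y) (c + d)).
Context (P_Z : forall a x c, a != 0 -> P x c -> P (a *: x) (`|a| * c)).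
Context (P_eq0 : forall x,
  (forall e, 0 < e -> exists2 c, c < e & P x c) -> x = 0).

Let has_infP x : has_inf [set c | P x c].
Proof. by split; [exact: P_ex | exists 0 => c /P_gt0/ltW]. Qed.

Lemma inf_norm_le x c : P x c -> inf [set c | P x c] <= c.
Proof. by move=> Pc; apply: ge_inf => //; case: (has_infP x). Qed.

Lemma inf_norm_ge0 x : 0 <= inf [set c | P x c].
Proof. by apply: lb_le_inf; [exact: P_ex | move=> c /P_gt0/ltW]. Qed.

Lemma inf_norm_lt x e : inf [set c | P x c] < e -> exists2 c, c < e & P x c.
Proof. by move=> /inf_lt[|c Pc ce]; [exact: P_ex | exists c]. Qed.

Lemma inf_normD x y :
  inf [set c | P (x + y) c] <= inf [set c | P x c] + inf [set c | P y c].
Proof.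
apply/ler_addgt0Pr => e e0; have e20 : 0 < e / 2 by rewrite divr_gt0.
have [c cx Pc] : exists2 c, c < inf [set c | P x c] + e / 2 & P x c.
  by apply: inf_norm_lt; rewrite ltrDl.
have [d dy Pd] : exists2 d, d < inf [set c | P y c] + e / 2 & P y d.
  by apply: inf_norm_lt; rewrite ltrDl.
rewrite (le_trans (inf_norm_le (P_D Pc Pd)))//.
by rewrite [in leRHS](splitr e) addrACA lerD// ltW.
Qed.

Lemma inf_norm0 : inf [set c | P 0 c] = 0.
Proof.
apply/le_anti; rewrite inf_norm_ge0 andbT; apply/ler_addgt0Pr => e e0.
by rewrite add0r; apply/inf_norm_le/P_0.
Qed.

Let inf_normZ_le a x : a != 0 ->
  inf [set c | P (a *: x) c] <= `|a| * inf [set c | P x c].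
Proof.
move=> a0; rewrite -ler_pdivrMl ?normr_gt0//.
apply: lb_le_inf; first exact: P_ex.
move=> c Pc; rewrite ler_pdivrMl ?normr_gt0//.
exact/inf_norm_le/P_Z.
Qed.

Lemma inf_normZ a x :
  inf [set c | P (a *: x) c] = `|a| * inf [set c | P x c].
Proof.
have [->|a0] := eqVneq a 0; first by rewrite scale0r normr0 mul0r inf_norm0.
apply/le_anti; rewrite inf_normZ_le//= -ler_pdivlMl ?normr_gt0//.
rewrite -normfV; have := @inf_normZ_le a^-1 (a *: x).
by rewrite scalerK// invr_eq0; exact.
Qed.

Lemma inf_norm_eq0 x : inf [set c | P x c] = 0 -> x = 0.
Proof. by move=> x0; apply: P_eq0 => e e0; apply: inf_norm_lt; rewrite x0. Qed.

End inf_norm.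

Record exponent (R : realType) := Exponent {
  expo :> nat -> \bar R ;
  expo_ge1 : forall k, (1 <= expo k)%E }.

Record finite_exponent (R : realType) := FiniteExponent {
  fexpo :> nat -> R ;
  fexpo_ge1 : forall k, 1 <= fexpo k }.

Section modular.
Context {R : realType}.
Implicit Types (q : exponent R) (x y z : nat -> R).
Local Open Scope ereal_scope.

(* 0 is added so that the supremum is 0 when q is everywhere finite (in \bar R
   the supremum of the empty set is -oo). *)
Definition modular q x : \bar R :=
  \sum_(k <oo | q k != +oo) (`|x k| `^ fine (q k))%:E +
  ereal_sup (0 |` [set `|x k|%:E | k in [set k | q k = +oo]]).

Lemma fine_expo_ge1 q k : q k != +oo -> (1 <= fine (q k))%R.
Proof. by move: (expo_ge1 q k); case: (q k) => //= r. Qed.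

Let modular2_ge0 q x :
  0 <= ereal_sup (0 |` [set `|x k|%:E | k in [set k | q k = +oo]]).
Proof. by apply: ereal_sup_ubound; left. Qed.

Lemma modular_ge0 q x : 0 <= modular q x.
Proof.
apply: adde_ge0 => //.
by apply: nneseries_ge0 => k _; rewrite lee_fin powR_ge0.
Qed.

Let powR_conv (r a b u v : R) : (1 <= r -> 0 <= a -> 0 <= b -> a + b = 1 ->
  0 <= u -> 0 <= v -> (a * u + b * v) `^ r <= a * u `^ r + b * v `^ r)%R.
Proof.
move=> r1 a0 b0 ab u0 v0.
have a1 : (a <= 1)%R by rewrite -ab lerDl.
have bE : b = (1 - a)%R by rewrite -ab addrC addKr.
have := convex_powR r1 (Itv01 a0 a1) (x := u) (y := v).
rewrite !inE/= !in_itv/= !andbT => /(_ u0 v0).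
by rewrite convRE [X in (X `^ _ <= _)%R -> _]convRE/= /unstable.onem -bE.
Qed.

Lemma modular_conv q x y z (a b : R) :
  (0 <= a)%R -> (0 <= b)%R -> (a + b = 1)%R ->
  (forall k, `|z k| <= a * `|x k| + b * `|y k|)%R ->
  modular q z <= a%:E * modular q x + b%:E * modular q y.
Proof.
move=> a0 b0 ab1 zxy.
have s_ge0 w : 0 <= \sum_(k <oo | q k != +oo) (`|w k| `^ fine (q k))%:E.
  by apply: nneseries_ge0 => k _; rewrite lee_fin powR_ge0.
rewrite /modular !ge0_muleDr//.
rewrite addeACA; apply: leeD.
  rewrite -!nneseriesZl; [|by move=> k _; rewrite lee_fin powR_ge0..].
  rewrite -nneseriesD; first last.
  - by move=> k _ _; rewrite mule_ge0// lee_fin powR_ge0.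
  - by move=> k _ _; rewrite mule_ge0// lee_fin powR_ge0.
  apply: lee_nneseries => [k _|k] qk; first by rewrite lee_fin powR_ge0.
  rewrite -!EFinM -EFinD lee_fin.
  have q1 := fine_expo_ge1 qk.
  rewrite (le_trans _ (powR_conv q1 _ _ _ _ _))//.
  rewrite ge0_ler_powR ?nnegrE ?(le_trans _ q1)//.
  by rewrite addr_ge0// mulr_ge0.
apply: ge_ereal_sup => _ [->|[k qk <-]]; first by rewrite adde_ge0 ?mule_ge0.
have le_sup (w : nat -> R) : `|w k|%:E <=
    ereal_sup (0 |` [set `|w k|%:E | k in [set k | q k = +oo]]).
  by apply: ereal_sup_ubound; right; exists k.
rewrite (@le_trans _ _ (a%:E * `|x k|%:E + b%:E * `|y k|%:E))//.
  by rewrite -!EFinM -EFinD lee_fin.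
by rewrite leeD// lee_wpmul2l.
Qed.

Lemma modular0 q : modular q 0%R = 0.
Proof.
rewrite /modular eseries0 ?add0e => [|k _ qk]; last first.
  by rewrite normr0 powR0// gt_eqF// (lt_le_trans _ (fine_expo_ge1 qk)).
apply/le_anti; rewrite modular2_ge0 andbT.
by apply: ge_ereal_sup => _ [->//|[k _ <-]]; rewrite normr0.
Qed.

Lemma modular_scale q x z (a : R) : (0 <= a <= 1)%R ->
  (forall k, `|z k| <= a * `|x k|)%R -> modular q z <= a%:E * modular q x.
Proof.
move=> /andP[a0 a1] zx.
rewrite (le_trans (@modular_conv q x 0%R z a (1 - a) _ _ _ _))//.
- by rewrite subr_ge0.
- by rewrite addrC subrK.
- by move=> k; rewrite normr0 mulr0 addr0.
- by rewrite modular0 mule0 adde0.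
Qed.

Lemma modular_le q x z : (forall k, `|z k| <= `|x k|)%R ->
  modular q z <= modular q x.
Proof.
move=> zx; rewrite -[leRHS]mul1e; apply: modular_scale; first by rewrite ler01/=.
by move=> k; rewrite mul1r.
Qed.

Lemma le1_modular q x k : modular q x <= 1 -> (`|x k| <= 1)%R.
Proof.
rewrite /modular => x1; have [qk|qk] := eqVneq (q k) +oo.
  rewrite -lee_fin (le_trans _ x1)// -[leLHS]add0e; apply: leeD.
    by apply: nneseries_ge0 => i _; rewrite lee_fin powR_ge0.
  by apply: ereal_sup_ubound; right; exists k.
have {}x1 : (`|x k| `^ fine (q k))%:E <= 1.
  rewrite (le_trans _ x1)// -[leLHS]adde0; apply: leeD => //.
  rewrite (nneseriesD1 (n := k))//.
  rewrite -[leLHS]adde0; apply: leeD => //.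
  by apply: nneseries_ge0 => i _ _; rewrite lee_fin powR_ge0.
rewrite leNgt; apply/negP => xk.
move: x1; rewrite lee_fin leNgt => /negP; apply; rewrite (lt_le_trans xk)//.
by apply: le1r_powR; [exact: ltW | exact: fine_expo_ge1].
Qed.

End modular.

Section lq.
Context {R : realType}.
Implicit Types (q : exponent R) (x y : nat -> R).

Definition in_lq q : {pred nat -> R} :=
  [pred x | `[< exists2 l : R, 0 < l &
                  (modular q (fun k => (x k / l)%R) < +oo)%E >]].

Definition lux_ball q x (l : R) : Prop :=
  0 < l /\ (modular q (fun k => (x k / l)%R) <= 1)%E.

Let conv_div (x y : R) l m : 0 < l -> 0 < m ->
  `|(x + y) / (l + m)| <= l / (l + m) * `|x / l| + m / (l + m) * `|y / m|.
Proof.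
move=> l0 m0; have lm0 : 0 < l + m by rewrite addr_gt0.
have E u n : 0 < n -> n / (l + m) * (u / n) = u / (l + m).
  by move=> n0; rewrite mulrC mulrA divfK// gt_eqF.
rewrite mulrDl -(E x l l0) -(E y m m0) (le_trans (ler_normD _ _))//.
by rewrite !(normrM (_ / (l + m))) !(gtr0_norm (divr_gt0 _ lm0)).
Qed.

Let modular_divD q x y (l m : R) : 0 < l -> 0 < m ->
  (modular q (fun k => ((x k + y k) / (l + m))%R) <=
   (l / (l + m))%:E * modular q (fun k => (x k / l)%R) +
   (m / (l + m))%:E * modular q (fun k => (y k / m)%R))%E.
Proof.
move=> l0 m0; have lm0 : 0 < l + m by rewrite addr_gt0.
apply: modular_conv.
- by rewrite divr_ge0// ltW.
- by rewrite divr_ge0// ltW.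
- by rewrite -mulrDl divff// gt_eqF.
- by move=> k; exact: conv_div.
Qed.

Let modular_divZ q a x (l : R) : a != 0 ->
  (modular q (fun k => ((a * x k) / (`|a| * l))%R) <=
   modular q (fun k => (x k / l)%R))%E.
Proof.
move=> a0; apply: modular_le => k.
by rewrite !normrM !normfV normrM normr_id invfM mulrACA divff ?mul1r// normr_eq0.
Qed.

Lemma lux_ballD q x y l m :
  lux_ball q x l -> lux_ball q y m -> lux_ball q (x + y) (l + m).
Proof.
move=> [l0 xl] [m0 ym]; split; first by rewrite addr_gt0.
have lm0 : 0 < l + m by rewrite addr_gt0.
apply: le_trans (modular_divD q x y l0 m0) _.
rewrite (@le_trans _ _ ((l / (l + m))%:E * 1 + (m / (l + m))%:E * 1)%E)//.
  by apply: leeD; apply: lee_wpmul2l => //; rewrite lee_fin divr_ge0// ltW.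
by rewrite !mule1 -EFinD -mulrDl divff// gt_eqF.
Qed.

Lemma lux_ballZ q a x l :
  a != 0 -> lux_ball q x l -> lux_ball q (a *: x) (`|a| * l).
Proof.
move=> a0 [l0 xl]; split; first by rewrite mulr_gt0// normr_gt0.
exact: le_trans (modular_divZ q x l a0) xl.
Qed.

Lemma lux_ball0 q l : 0 < l -> lux_ball q 0 l.
Proof.
move=> l0; split => //; rewrite (_ : (fun _ => _) = 0) ?modular0//.
by apply/funext => k; rewrite mul0r.
Qed.

Lemma lux_ball_eq0 q x :
  (forall e, 0 < e -> exists2 l, l < e & lux_ball q x l) -> x = 0.
Proof.
move=> xe; apply/funext => k; apply/eqP; rewrite -normr_eq0.
rewrite eq_le normr_ge0 andbT; apply/ler_addgt0Pr => e e0; rewrite add0r.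
have [l le [l0 /(@le1_modular _ _ _ k)]] := xe _ e0.
rewrite normrM normfV (gtr0_norm l0) ler_pdivrMr// mul1r => /le_trans; apply.
exact: ltW.
Qed.

Lemma lux_ball_ex q x : x \in in_lq q -> exists l, lux_ball q x l.
Proof.
move=> /asboolP[l l0 xl].
have /ge0_fin_numE := modular_ge0 q (fun k => x k / l).
rewrite xl => /fineK Ec; set c := fine _ in Ec.
have c0 : 0 <= c by rewrite fine_ge0// modular_ge0.
have d0 : 0 < 1 + c by rewrite ltr_pwDl.
exists ((1 + c) * l); split; first by rewrite mulr_gt0.
rewrite (le_trans (@modular_scale _ q (fun k => x k / l) _ (1 + c)^-1 _ _))//.
- by rewrite invr_ge0 ltW//= invf_le1// lerDl.
- by move=> k; rewrite invfM mulrCA normrM gtr0_norm// invr_gt0.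
- by rewrite -Ec -EFinM lee_fin mulrC ler_pdivrMr// mul1r lerDr.
Qed.

Lemma in_lq_submod_closed q : submod_closed (in_lq q).
Proof.
split.
  apply/asboolP; exists 1 => //.
  by have [_ /le_lt_trans ->//] := lux_ball0 q (@ltr01 R); rewrite ltry.
move=> a x y /lux_ball_ex[l xl] /lux_ball_ex[m ym].
suff [n [n0 /le_lt_trans nlt]] : exists n, lux_ball q (a *: x + y) n.
  by apply/asboolP; exists n => //; rewrite nlt// ltry.
have [->|a0] := eqVneq a 0; first by exists m; rewrite scale0r add0r.
by exists (`|a| * l + m); apply: lux_ballD => //; exact: lux_ballZ.
Qed.

HB.instance Definition _ q :=
  GRing.isSubmodClosed.Build R (nat -> R) (in_lq q) (in_lq_submod_closed q).

End lq.

Record lq (R : realType) (q : exponent R) := Lq {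
  lq_val :> nat -> R ;
  lqP : lq_val \in in_lq q }.

Section lq_normed.
Context {R : realType} (q : exponent R).

HB.instance Definition _ := [isSub for @lq_val R q].
HB.instance Definition _ := [Choice of lq q by <:].
HB.instance Definition _ := [SubChoice_isSubLmodule of lq q by <:].

Definition lq_norm (x : lq q) : R := inf [set l | lux_ball q x l].

Let gt0 (x : lq q) l : lux_ball q x l -> 0 < l. Proof. by case. Qed.
Let ex (x : lq q) : exists l, lux_ball q x l.
Proof. exact/lux_ball_ex/lqP. Qed.
Let ball0 l : 0 < l -> lux_ball q (0 : lq q) l.
Proof. exact: lux_ball0. Qed.
Let ballD (x y : lq q) l m :
  lux_ball q x l -> lux_ball q y m -> lux_ball q (x + y : lq q) (l + m).
Proof. exact: lux_ballD. Qed.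
Let ballZ a (x : lq q) l :
  a != 0 -> lux_ball q x l -> lux_ball q (a *: x : lq q) (`|a| * l).
Proof. exact: lux_ballZ. Qed.
Let ball_eq0 (x : lq q) :
  (forall e, 0 < e -> exists2 l, l < e & lux_ball q x l) -> x = 0.
Proof. by move=> /lux_ball_eq0 x0; exact: val_inj. Qed.

HB.instance Definition _ := @Lmodule_isNormed.Build R (lq q) lq_norm
  (inf_normD gt0 ex ballD) (inf_normZ gt0 ex ball0 ballZ)
  (inf_norm_eq0 ex ball_eq0).

End lq_normed.

Section dual_exponent.
Context {R : realType} (q : exponent R).

Lemma hoelder_conjugate_ge1 k : (1 <= hoelder_conjugate (q k))%E.
Proof.
move: (expo_ge1 q k); case: (q k) => [r r1|_|//]; last first.
  by rewrite hoelder_conjugatey.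
have r0 : 0 < r by rewrite (lt_le_trans ltr01).
have [->|rN1] := eqVneq r 1; first by rewrite hoelder_conjugate1 leey.
have {}r1 : 1 < r by rewrite lt_neqAle eq_sym rN1.
rewrite /hoelder_conjugate/= eqe gt_eqF// -EFinD inver subr_eq0 (negbTE rN1).
by rewrite -EFinM lee_fin ler_pdivlMr ?subr_gt0// mul1r gerBl.
Qed.

Definition dual_exponent : exponent R := Exponent hoelder_conjugate_ge1.

Lemma dual_exponentE k : ((q k)^-1 + (dual_exponent k)^-1 = 1)%E.
Proof.
have q0 : (0 < q k)%E by rewrite (lt_le_trans _ (expo_ge1 q k)).
by rewrite hoelder_conjugate_eq1 ?(lt_trans _ q0)// gt_eqF.
Qed.

End dual_exponent.

Section dual.
Context {R : realType} (V : normedModType R).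

Definition functional_bound (f : V -> R) (c : R) : Prop :=
  0 < c /\ forall x, `|f x| <= c * `|x|.

Definition bounded_functional : {pred V -> R} :=
  [pred f | `[< linear f /\ exists c, functional_bound f c >]].

Let boundD (f g : V -> R) c d : functional_bound f c ->
  functional_bound g d -> functional_bound (f + g) (c + d).
Proof.
move=> [c0 fc] [d0 gd]; split; first by rewrite addr_gt0.
by move=> x; rewrite (le_trans (ler_normD _ _))// mulrDl lerD.
Qed.

Let boundZ a (f : V -> R) c : a != 0 -> functional_bound f c ->
  functional_bound (a *: f) (`|a| * c).
Proof.
move=> a0 [c0 fc]; split; first by rewrite mulr_gt0// normr_gt0.
by move=> x; rewrite normrM -mulrA ler_wpM2l.
Qed.

Let bound0 c : 0 < c -> functional_bound 0 c.
Proof. by move=> c0; split => // x; rewrite normr0 mulr_ge0// ltW. Qed.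

Lemma bounded_functional_submod_closed : submod_closed bounded_functional.
Proof.
split.
  apply/asboolP; split; first by move=> a x y; rewrite scaler0 addr0.
  by exists 1; exact: bound0.
move=> a f g /asboolP[lf [c fc]] /asboolP[lg [d gd]]; apply/asboolP; split.
  move=> b x y; have fE := lf b x y; have gE := lg b x y.
  change (a * f (b *: x + y) + g (b *: x + y) =
          b * (a * f x + g x) + (a * f y + g y)).
  rewrite fE gE; change (a * (b * f x + f y) + (b * g x + g y) =
          b * (a * f x + g x) + (a * f y + g y)).
  by rewrite !mulrDr (mulrCA b) addrACA.
have [->|a0] := eqVneq a 0; first by exists d; rewrite scale0r add0r.
by exists (`|a| * c + d); apply: boundD => //; exact: boundZ.
Qed.

HB.instance Definition _ := GRing.isSubmodClosed.Build R (V -> R)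
  bounded_functional bounded_functional_submod_closed.

Record dual := Dual {
  dual_val :> V -> R ;
  dualP : dual_val \in bounded_functional }.

HB.instance Definition _ := [isSub for dual_val].
HB.instance Definition _ := [Choice of dual by <:].
HB.instance Definition _ := [SubChoice_isSubLmodule of dual by <:].

Definition dual_norm (f : dual) : R := inf [set c | functional_bound f c].

Let gt0 (f : dual) c : functional_bound f c -> 0 < c. Proof. by case. Qed.
Let ex (f : dual) : exists c, functional_bound f c.
Proof. by have /asboolP[] := dualP f. Qed.
Let ball0 c : 0 < c -> functional_bound (0 : dual) c.
Proof. exact: bound0. Qed.
Let ballD (f g : dual) c d : functional_bound f c -> functional_bound g d ->
  functional_bound (f + g : dual) (c + d).
Proof. exact: boundD. Qed.
Let ballZ a (f : dual) c : a != 0 -> functional_bound f c ->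
  functional_bound (a *: f : dual) (`|a| * c).
Proof. exact: boundZ. Qed.
Let ball_eq0 (f : dual) :
  (forall e, 0 < e -> exists2 c, c < e & functional_bound f c) -> f = 0.
Proof.
move=> f0; apply/val_inj/funext => x; apply/eqP; rewrite -normr_eq0.
rewrite eq_le normr_ge0 andbT; apply/ler_addgt0Pr => e e0; rewrite add0r.
have x1 : 0 < `|x| + 1 by rewrite ltr_wpDl.
have [c ce [c0 /(_ x) /le_trans]] := f0 _ (divr_gt0 e0 x1); apply.
rewrite (@le_trans _ _ (c * (`|x| + 1)))//.
  by rewrite ler_pM2l// lerDl.
by rewrite -ler_pdivlMr// ltW.
Qed.

HB.instance Definition _ := @Lmodule_isNormed.Build R dual dual_norm
  (inf_normD gt0 ex ballD) (inf_normZ gt0 ex ball0 ballZ)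
  (inf_norm_eq0 ex ball_eq0).

End dual.

Definition isomorphic {R : realType} (V W : normedModType R) : Prop :=
  exists (f : {linear V -> W}) (g : {linear W -> V}),
    [/\ cancel f g, cancel g f,
        bounded_near f (nbhs 0) & bounded_near g (nbhs 0)].

Section extended_exponent.
Context {R : realType} (p : finite_exponent R).

Lemma EFin_fexpo_ge1 k : (1 <= (p k)%:E)%E.
Proof. by rewrite lee_fin fexpo_ge1. Qed.

Definition extended_exponent : exponent R := Exponent EFin_fexpo_ge1.

End extended_exponent.

Notation lp p := (lq (extended_exponent p)).

Section content.
Context {R : realType} (p : finite_exponent R).

Definition finite_content (A : set nat) : Prop :=
  exists2 B : R, 1 < B & (\sum_(k <oo | k \in A) (B `^ (- p k))%:E < +oo)%E.

Record content_set := ContentSet {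
  content_val :> set nat ;
  contentP : finite_content content_val }.

Lemma finite_contentU (A B : content_set) : finite_content (A `|` B).
Proof.
have [a a1 Aa] := contentP A; have [b b1 Bb] := contentP B.
pose c := Num.max a b.
have c1 : 1 < c by rewrite lt_max a1.
have le_c d k : 1 < d -> d <= c -> c `^ (- p k) <= d `^ (- p k).
  move=> d1 dc; have d0 : 0 < d by rewrite (lt_trans ltr01).
  have p0 : 0 <= p k by rewrite (le_trans _ (fexpo_ge1 p k)).
  rewrite !powRN lef_pV2 ?posrE ?powR_gt0// ?(lt_le_trans d0)//.
  by rewrite ge0_ler_powR// nnegrE ltW// (lt_le_trans d0).
exists c => //.
rewrite (@le_lt_trans _ _ (\sum_(k <oo | k \in (A : set nat)) (a `^ (- p k))%:E +
                    \sum_(k <oo | k \in (B : set nat)) (b `^ (- p k))%:E)%E)//.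
  rewrite eseries_mkcond [X in (_ <= X + _)%E]eseries_mkcond.
  rewrite [X in (_ <= _ + X)%E]eseries_mkcond.
  rewrite -nneseriesD; first last.
  - by move=> k _ _; case: ifP => // _; rewrite lee_fin powR_ge0.
  - by move=> k _ _; case: ifP => // _; rewrite lee_fin powR_ge0.
  apply: lee_nneseries => k _.
    by case: ifP => // _; rewrite lee_fin powR_ge0.
  rewrite in_setU; case: (k \in (A : set nat)) => /=; last first.
    rewrite add0e; case: ifP => // _.
    by rewrite lee_fin le_c// le_max lexx orbT.
  rewrite -[leLHS]adde0 leeD//; first by rewrite lee_fin le_c// le_max lexx.
  by case: ifP => // _; rewrite lee_fin powR_ge0.
by rewrite lte_add_pinfty.
Qed.

Definition contentU (A B : content_set) : content_set :=
  ContentSet (finite_contentU A B).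

Lemma indic_in_lp (A : content_set) :
  (\1_(A : set nat) : nat -> R) \in in_lq (extended_exponent p).
Proof.
have [B B1 AB] := contentP A; have B0 : 0 < B by rewrite (lt_trans ltr01).
apply/asboolP; exists B => //; rewrite /modular.
rewrite (_ : [set _ | _ in _] = set0); last first.
  by apply/seteqP; split => // y [k /=].
rewrite setU0 ereal_sup1 adde0; apply: le_lt_trans AB.
rewrite [leRHS]eseries_mkcond lee_nneseries// => k _.
have p1 := fexpo_ge1 p k.
rewrite indicE normrM normfV normr_nat (gtr0_norm B0); case: ifPn => kA.
  by rewrite mul1r -(powR_inv1 (ltW B0)) -powRrM mulN1r.
by rewrite /= mul0r powR0// gt_eqF// (lt_le_trans _ p1).
Qed.

Definition lp_indic (A : content_set) : lp p := Lq (indic_in_lp A).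

Definition simple_sequences : set (lp p) :=
  [set x | exists (N : nat) (a : 'I_N -> R) (A : 'I_N -> content_set),
    trivIset setT (fun i => A i : set nat) /\
    x = \sum_(i < N) a i *: lp_indic (A i)].

Definition lp_b : set (lp p) :=
  [set x | exists M : R, forall k, x k != 0 -> p k <= M].

(* The norm of the class of x in the quotient of lp p by the closure of lp_b *)
Definition germ_norm (x : lp p) : R :=
  inf [set `|x - y| | y in closure lp_b].

Definition omega (A : content_set) : R := germ_norm (lp_indic A).

Lemma omega_ge0 A : 0 <= omega A.
Proof.
rewrite /omega /germ_norm.
have [->|/set0P[y Sy]] := eqVneq [set `|lp_indic A - y| | y in closure lp_b] set0.
  by rewrite inf0.
by apply: lb_le_inf => [|_ [z _ <-]]; [exists y|].
Qed.

(* In \bar R, c / 0 = +oo for c > 0 and 0 / 0 = 0 * +oo = 0. *)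
Definition variation_bound (mu : content_set -> R) (c : R) : Prop :=
  0 < c /\ forall (n : nat) (A : 'I_n -> content_set),
    trivIset setT (fun i => A i : set nat) ->
    (\sum_(i < n) `|mu (A i)|%:E / (omega (A i))%:E <= c%:E)%E.

Definition finitely_additive (mu : content_set -> R) : Prop :=
  forall A B : content_set, A `&` B = set0 ->
    mu (contentU A B) = mu A + mu B.

Definition in_pba : {pred content_set -> R} :=
  [pred mu | `[< finitely_additive mu /\ exists c, variation_bound mu c >]].

Let omegaV_ge0 A : (0 <= (omega A)%:E^-1)%E.
Proof. by rewrite inve_ge0 lee_fin omega_ge0. Qed.

Let term_ge0 (mu : content_set -> R) A :
  (0 <= `|mu A|%:E / (omega A)%:E)%E.
Proof. by rewrite mule_ge0 ?lee_fin. Qed.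

Let boundD (mu nu : content_set -> R) c d : variation_bound mu c ->
  variation_bound nu d -> variation_bound (mu + nu) (c + d).
Proof.
move=> [c0 muc] [d0 nud]; split; first by rewrite addr_gt0.
move=> n A tA; rewrite EFinD (le_trans _ (leeD (muc n A tA) (nud n A tA)))//.
rewrite -big_split/=; apply: lee_sum => i _.
rewrite -ge0_muleDl ?lee_fin// lee_wpmul2r// -EFinD lee_fin.
exact: ler_normD.
Qed.

Let boundZ a (mu : content_set -> R) c : a != 0 -> variation_bound mu c ->
  variation_bound (a *: mu) (`|a| * c).
Proof.
move=> a0 [c0 muc]; split; first by rewrite mulr_gt0// normr_gt0.
move=> n A tA; rewrite EFinM.
rewrite (le_trans _ (lee_wpmul2l _ (muc n A tA))) ?lee_fin//.
rewrite ge0_sume_distrr => [|i _]; last exact: term_ge0.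
apply: lee_sum => i _.
by rewrite muleA -EFinM -normrM.
Qed.

Let bound0 c : 0 < c -> variation_bound 0 c.
Proof.
move=> c0; split => // n A _; rewrite big1 ?lee_fin ?ltW// => i _.
by rewrite normr0 mul0e.
Qed.

Lemma in_pba_submod_closed : submod_closed in_pba.
Proof.
split.
  apply/asboolP; split; first by move=> A B _; rewrite addr0.
  by exists 1; exact: bound0.
move=> a mu nu /asboolP[lmu [c muc]] /asboolP[lnu [d nud]].
apply/asboolP; split.
  move=> A B AB; have := lmu A B AB; have := lnu A B AB.
  move=> nuE muE; change (a * mu (contentU A B) + nu (contentU A B) =
    a * mu A + nu A + (a * mu B + nu B)).
  by rewrite nuE muE mulrDr addrACA.
have [->|a0] := eqVneq a 0; first by exists d; rewrite scale0r add0r.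
by exists (`|a| * c + d); apply: boundD => //; exact: boundZ.
Qed.

HB.instance Definition _ := GRing.isSubmodClosed.Build R (content_set -> R)
  in_pba in_pba_submod_closed.

Record pba := Pba {
  pba_val :> content_set -> R ;
  pbaP : pba_val \in in_pba }.

HB.instance Definition _ := [isSub for pba_val].
HB.instance Definition _ := [Choice of pba by <:].
HB.instance Definition _ := [SubChoice_isSubLmodule of pba by <:].

Definition pba_norm (mu : pba) : R := inf [set c | variation_bound mu c].

Let gt0 (mu : pba) c : variation_bound mu c -> 0 < c. Proof. by case. Qed.
Let ex (mu : pba) : exists c, variation_bound mu c.
Proof. by have /asboolP[] := pbaP mu. Qed.
Let ball0 c : 0 < c -> variation_bound (0 : pba) c.
Proof. exact: bound0. Qed.
Let ballD (mu nu : pba) c d : variation_bound mu c -> variation_bound nu d ->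
  variation_bound (mu + nu : pba) (c + d).
Proof. exact: boundD. Qed.
Let ballZ a (mu : pba) c : a != 0 -> variation_bound mu c ->
  variation_bound (a *: mu : pba) (`|a| * c).
Proof. exact: boundZ. Qed.
Let ball_eq0 (mu : pba) :
  (forall e, 0 < e -> exists2 c, c < e & variation_bound mu c) -> mu = 0.
Proof.
move=> mu0; apply/val_inj/funext => A; apply/eqP.
have muA0 : (`|mu A|%:E / (omega A)%:E = 0)%E.
  apply/le_anti; rewrite term_ge0 andbT; apply/lee_addgt0Pr => e e0.
  have [c ce [c0 /(_ 1%N (fun=> A))]] := mu0 _ e0.
  rewrite add0e big_ord1 => /(_ _)/le_trans; apply.
    by move=> i j _ _ _; rewrite (ord1 i) (ord1 j).
  by rewrite lee_fin ltW.
move/eqP: muA0; rewrite mule_eq0 inve_eq0 orbF.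
by rewrite eqe normr_eq0.
Qed.

HB.instance Definition _ := @Lmodule_isNormed.Build R pba pba_norm
  (inf_normD gt0 ex ballD) (inf_normZ gt0 ex ball0 ballZ)
  (inf_norm_eq0 ex ball_eq0).

End content.

Arguments content_set {R} p.
Arguments simple_sequences {R} p.
Arguments lp_b {R} p.
Arguments pba {R} p.

(* Main.v *)
(* A functional f on lp p is split along the unit vectors e_k. Its coefficients
   y k = f e_k lie in the dual sequence space, and f - <y, .> vanishes on the
   e_k, hence on every sequence with p bounded on its support: it is controlled
   by the germ norm, and is determined by its values mu A on indicators because
   simple sequences are dense. The germ norm of x is the infimum of the l with
   finite modular of x / l, so on disjoint sums of a_i 1_(A_i) it is the maximum
   of the |a_i| omega(A_i); dual to this maximum norm is the l^1-type condition
   defining the variation of mu. *)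
From HB Require Import structures.
Require Import Defs.
From mathcomp Require Import all_boot all_order all_algebra.
From mathcomp Require Import all_classical all_reals all_analysis.

From mathcomp Require Import ring lra.

Set Implicit Arguments.
Unset Strict Implicit.
Unset Printing Implicit Defensive.

Import Order.TTheory GRing.Theory Num.Theory.
Import numFieldNormedType.Exports.

Local Open Scope classical_set_scope.
Local Open Scope ring_scope.

(** * Division and series in the extended reals *)

Lemma EFin_div {R : realType} (a b : R) :
  (b = 0 -> a = 0) -> (a%:E / b%:E = (a / b)%:E)%E.
Proof.
have [-> /(_ erefl) ->|b0 _] := eqVneq b 0; first by rewrite mul0e mul0r.
by rewrite inver (negbTE b0).
Qed.

Lemma nneseries_le {R : realType} (P : pred nat) (u : nat -> \bar R)
    (c : \bar R) :
  (forall k, P k -> (0 <= u k)%E) ->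
  (forall n, (\sum_(0 <= k < n | P k) u k <= c)%E) ->
  (\sum_(k <oo | P k) u k <= c)%E.
Proof.
move=> u0 uc; apply: lime_le.
  by apply: is_cvg_nneseries_cond => k _; exact: u0.
by apply: nearW => n; exact: uc.
Qed.

(** * Extending a bounded linear relation with dense domain *)

Section dense_extension.
Context {R : realType} {V : normedModType R} (G : V -> R -> Prop) (C : R).
Hypothesis C_ge0 : 0 <= C.
Hypothesis G_lin : forall a x y c d,
  G x c -> G y d -> G (a *: x + y) (a * c + d).
Hypothesis G_bound : forall x c, G x c -> `|c| <= C * `|x|.
Hypothesis G_dense : dense [set x | exists c, G x c].

Let approx y (e : R) : 0 < e -> exists x c, G x c /\ `|y - x| < e.
Proof.
move=> e0; have [|x [yx [c Gxc]]] := G_dense _ (@ball_open R V y e).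
  by exists y; exact: ballxx.
by exists x, c; split=> //; move: yx; rewrite -ball_normE.
Qed.

(* A norm-bounded linear graph over a dense domain: this infimum is the limit of
   the values c as x tends to y, so no completeness argument is needed. *)
Let F y := inf [set C * `|y - w.1| + w.2 | w in [set w | G w.1 w.2]].

Let G_dist x c x' c' : G x c -> G x' c' -> `|c - c'| <= C * `|x - x'|.
Proof.
move=> Gx Gx'; apply: G_bound.
have := G_lin (-1) Gx' Gx.
by rewrite scaleN1r mulN1r ![- _ + _]addrC.
Qed.

(** [F] is McShane's formula for extending a [C]-Lipschitz function. By [G_dist], c - C |y - x| lies
    below every member of the infimum, and c + C |y - x| is itself a member. *)
Let F_dist y x c : G x c -> `|F y - c| <= C * `|y - x|.
Proof.
move=> Gx.
have lbF : lbound [set C * `|y - w.1| + w.2 | w in [set w | G w.1 w.2]]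
    (c - C * `|y - x|).
  move=> _ [[x' c'] /= Gx' <-]; rewrite lerBlDr addrAC -lerBlDr.
  apply: le_trans (ler_norm _) _; apply: le_trans (G_dist Gx Gx') _.
  by rewrite -mulrDr ler_wpM2l// (distrC y x) [leRHS]addrC ler_distD.
rewrite ler_distl; apply/andP; split.
  by apply: lb_le_inf => //; exists (C * `|y - x| + c), (x, c).
rewrite [leRHS]addrC; apply: ge_inf; first by eexists; exact: lbF.
by exists (x, c).
Qed.

(** By [F_dist], [F y] is within C |y - x| of any graph value at [x], so linearity and the bound
    pass to the limit. At x = y the distance is 0, which also shows the relation to be
    single-valued. *)
Lemma dense_linear_extension : exists F : V -> R,
  [/\ linear F, forall y, `|F y| <= C * `|y| & forall x c, G x c -> F x = c].
Proof.
have G_F x c : G x c -> F x = c.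
  move=> Gx; apply/eqP; rewrite -subr_eq0 -normr_le0.
  by rewrite (le_trans (F_dist x Gx))// subrr normr0 mulr0.
have small (c K : R) : 0 <= K -> (forall e, 0 < e -> `|c| <= K * e) -> c = 0.
  move=> K0 cK; apply/eqP; rewrite -normr_le0; apply/ler_addgt0Pr => e e0.
  have K1 : 0 < K + 1 by rewrite ltr_wpDl.
  rewrite add0r (le_trans (cK (e / (K + 1)) _)) ?divr_gt0//.
  by rewrite mulrCA ler_piMr ?ltW// ltr_pdivrMr// mul1r ltrDl.
exists F; split => //.
- move=> a y z; apply/eqP; rewrite -subr_eq0; apply/eqP.
  (* Two errors of at most C (|a| + 1) e each: one from [F] at [a *: y + z], one from [F] at [y] and
     [z]. *)
  apply: (small _ ((C * (`|a| + 1)) * 2)).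
    by rewrite !mulr_ge0// addr_ge0.
  move=> e e0.
  have [x [c [Gx yx]]] := approx y e0; have [x' [c' [Gx' zx']]] := approx z e0.
  have FE : F (a *: y + z) - (a * F y + F z) =
    (F (a *: y + z) - (a * c + c')) - (a * (F y - c) + (F z - c')).
    by rewrite mulrBr; lra.
  rewrite FE (le_trans (ler_normB _ _))// mulrAC mulr_natr mulr2n lerD//.
    rewrite (le_trans (F_dist _ (G_lin a Gx Gx')))// -mulrA ler_wpM2l//.
    rewrite opprD addrACA -scalerBr (le_trans (ler_normD _ _))// normrZ.
    by rewrite mulrDl mul1r lerD ?ler_wpM2l// ltW.
  rewrite (le_trans (ler_normD _ _))// normrM.
  rewrite mulrDr mulr1 mulrDl lerD//.
    rewrite (mulrC C) -mulrA ler_wpM2l// (le_trans (F_dist _ Gx))//.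
    by rewrite ler_wpM2l// ltW.
  by rewrite (le_trans (F_dist _ Gx'))// ler_wpM2l// ltW.
- move=> y; apply/ler_addgt0Pr => e e0.
  (* The estimate costs C |y - x| twice, in |F y - c| and in |x| <= |y| + |y - x|; adding 1 keeps
     the divisor positive when [C] is 0. *)
  have C1 : 0 < C + C + 1 by rewrite ltr_wpDl// addr_ge0.
  have [x [c [Gx yx]]] := approx y (divr_gt0 e0 C1).
  have -> : F y = (F y - c) + c by rewrite subrK.
  rewrite (le_trans (ler_normD _ _))//.
  apply: le_trans (lerD (F_dist _ Gx) (G_bound Gx)) _.
  have xy : `|x| <= `|y| + `|y - x|.
    by rewrite -[X in `|X| <= _](subKr y) (le_trans (ler_normB _ _)).
  have ye : (C + C + 1) * `|y - x| <= e by rewrite mulrC -ler_pdivlMr// ltW.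
  by have := normr_ge0 (y - x); have := ler_wpM2l C_ge0 xy; lra.
Qed.

End dense_extension.

(** * Norms as infima of admissible bounds *)

Section luxemburg_norm.
Context {R : realType} (q : exponent R).

Let ball_gt0 (x : lq q) l : lux_ball q x l -> 0 < l.
Proof. by case. Qed.

Let ball_ex (x : lq q) : exists l, lux_ball q x l.
Proof. exact/lux_ball_ex/lqP. Qed.

Lemma lq_norm_le (x : lq q) l : lux_ball q x l -> `|x| <= l.
Proof. exact: (inf_norm_le ball_gt0 ball_ex). Qed.

(** Admissible radii are upward closed, so any radius strictly above the norm is admissible, whether
    or not the infimum is attained. Later estimates start from |x| + e for this reason. *)
Lemma lux_ball_norm_lt (x : lq q) l : `|x| < l -> lux_ball q x l.
Proof.
move=> /(inf_norm_lt ball_ex) [m ml [m0 xm]]; have l0 := lt_trans m0 ml.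
split=> //; apply: le_trans xm; apply: modular_le => k.
rewrite !normrM ler_wpM2l// !normfV !gtr0_norm//.
by rewrite lef_pV2// ltW.
Qed.

Lemma lq_val_lin (a : R) (x y : lq q) k : (a *: x + y) k = a * x k + y k.
Proof. by []. Qed.

Lemma lq_valZ (a : R) (x : lq q) k : (a *: x) k = a * x k.
Proof. by []. Qed.

Lemma lq_valB (x y : lq q) k : (x - y) k = x k - y k.
Proof. by []. Qed.

Lemma lq_val_sum I (r : seq I) (P : pred I) (F : I -> lq q) k :
  (\sum_(i <- r | P i) F i) k = \sum_(i <- r | P i) F i k.
Proof. exact: (big_morph (fun x : lq q => x k)). Qed.

End luxemburg_norm.

Section dual_norm.
Context {R : realType} {V : normedModType R}.
Implicit Type f : dual V.

Let bound_gt0 f c : functional_bound f c -> 0 < c.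
Proof. by case. Qed.

Let bound_ex f : exists c, functional_bound f c.
Proof. by have /asboolP[] := dualP f. Qed.

Lemma dual_norm_le f c : functional_bound f c -> `|f| <= c.
Proof. exact: (inf_norm_le bound_gt0 bound_ex). Qed.

Lemma functional_bound_norm_lt f c : `|f| < c -> functional_bound f c.
Proof.
move=> /(inf_norm_lt bound_ex) [m ml [m0 fm]]; split; first exact: lt_trans m0 ml.
by move=> x; rewrite (le_trans (fm x))// ler_wpM2r// ltW.
Qed.

Lemma dual_linear f : linear f.
Proof. by have /asboolP[] := dualP f. Qed.

HB.instance Definition _ f :=
  GRing.isLinear.Build R V R *%R f (dual_linear f).

End dual_norm.

Section pba_norm.
Context {R : realType} {p : finite_exponent R}.
Implicit Type mu : pba p.

Let bound_gt0 mu c : variation_bound mu c -> 0 < c.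
Proof. by case. Qed.

Let bound_ex mu : exists c, variation_bound mu c.
Proof. by have /asboolP[] := pbaP mu. Qed.

Lemma pba_norm_le mu c : variation_bound mu c -> `|mu| <= c.
Proof. exact: (inf_norm_le bound_gt0 bound_ex). Qed.

Lemma variation_bound_norm_lt mu c : `|mu| < c -> variation_bound mu c.
Proof.
move=> /(inf_norm_lt bound_ex) [m ml [m0 mum]]; split; first exact: lt_trans m0 ml.
by move=> n A tA; rewrite (le_trans (mum n A tA))// lee_fin ltW.
Qed.

End pba_norm.

(** * Unit sequences, truncations and tails *)

Section lp.
Context {R : realType} (p : finite_exponent R).
Local Notation rho := (modular (extended_exponent p)).

Lemma fexpo_gt0 k : 0 < p k.
Proof. exact: lt_le_trans (fexpo_ge1 p k). Qed.

Lemma modular_finite x : rho x = (\sum_(k <oo) (`|x k| `^ p k)%:E)%E.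
Proof.
rewrite /modular (_ : [set _ | _ in _] = set0); last first.
  by apply/seteqP; split => // y [k /=].
by rewrite setU0 ereal_sup1 adde0; exact: eq_eseriesl.
Qed.

Lemma finite_content1 k : finite_content p [set k].
Proof.
exists 2; first by rewrite ltr1n.
rewrite (nneseriesD1 (n := k)) ?inE//.
rewrite eseries0; first by rewrite adde0 ltry.
by move=> n _ /andP[]; rewrite inE => -> /eqP.
Qed.

Definition content1 k : content_set p := ContentSet (finite_content1 k).

Lemma lp_indicE (A : content_set p) k :
  lp_indic A k = (k \in (A : set nat))%:R.
Proof. by rewrite /= indicE. Qed.

(** Taken as the indicator of a singleton, so that [omega] and set functions apply to it
    directly. *)
Definition unit_seq k : lp p := lp_indic (content1 k).

Lemma unit_seqE k i : unit_seq k i = (i == k)%:R.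
Proof.
rewrite lp_indicE; case: eqVneq => [->|/eqP ik]; first by rewrite mem_set.
by rewrite memNset.
Qed.

(** The truncation of [a], written as a linear combination so that a functional acts on it term by
    term. *)
Definition lp_prefix (a : nat -> R) n : lp p :=
  \sum_(0 <= k < n) a k *: unit_seq k.

Lemma lp_prefixE a n i : lp_prefix a n i = if (i < n)%N then a i else 0.
Proof.
rewrite lq_val_sum.
under eq_bigr => k _.
  by rewrite lq_valZ unit_seqE; over.
case: ifPn => [ni|ni].
  rewrite (bigD1_seq i) ?mem_index_iota ?iota_uniq//= eqxx mulr1 big1 ?addr0//.
  by move=> k; rewrite eq_sym => /negbTE ->; rewrite mulr0.
rewrite big_nat big1// => k kn; case: eqVneq => [ik|]; last by rewrite mulr0.
by move: ni; rewrite ik; case/andP: kn => _ ->.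
Qed.

(** Tails of a convergent series tend to 0, hence eventually drop below 1. *)
Lemma modular_tail x : (rho x < +oo)%E ->
  exists n, (rho (fun k => if (k < n)%N then 0%R else x k) <= 1)%E.
Proof.
rewrite modular_finite => xl.
have x0 k : (0 <= (`|x k| `^ p k)%:E)%E by rewrite lee_fin powR_ge0.
have /fine_cvgP[fin /cvgrPdist_lt/(_ _ ltr01) lt1] :=
  nneseries_tail_cvg xl (fun k _ => x0 k).
near \oo => n; exists n.
rewrite modular_finite (nneseries_split 0 n)//.
rewrite add0n big_nat big1 ?add0e; last first.
  by move=> k /andP[_ ->]; rewrite normr0 powR0// gt_eqF// fexpo_gt0.
rewrite (_ : limn _ = (\sum_(n <= k <oo) (`|x k| `^ p k)%:E)%E); last first.
  apply/congr_lim/funext => m; apply: eq_big_nat => k /andP[nk _].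
  by rewrite ltnNge nk.
have Fn : (\sum_(n <= k <oo) (`|x k| `^ p k)%:E)%E \is a fin_num by near: n.
rewrite -(fineK Fn) lee_fin (le_trans (ler_norm _))// ltW//.
by rewrite -normrN -sub0r; near: n.
Unshelve. all: by end_near.
Qed.

End lp.

(** * The Hölder pairing with the dual sequence space *)

Section duality.
Context {R : realType} (p : finite_exponent R).
Local Notation rho := (modular (extended_exponent p)).
Local Notation p' := (dual_exponent (extended_exponent p)).
Implicit Types (x : lp p) (y : lq p') (f : dual (lp p)).

Lemma dual_exponent1 k : p k = 1 -> p' k = +oo%E.
Proof. by move=> pk; rewrite /= pk hoelder_conjugate1. Qed.

Lemma dual_exponent_neq1 k : p k != 1 -> exists r : R,
  [/\ p' k = r%:E, 0 < r & (p k)^-1 + r^-1 = 1].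
Proof.
move=> pk; have pk0 := fexpo_gt0 p k.
have := dual_exponentE (extended_exponent p) k.
have := expo_ge1 p' k; case E: (p' k) => [r| |//].
  rewrite lee_fin => r1; have r0 : 0 < r by exact: lt_le_trans r1.
  by rewrite /= !inver !gt_eqF// -EFinD => -[pr]; exists r.
rewrite /= inver gt_eqF// invey adde0 => _ [] /eqP.
by rewrite invr_eq1 (negbTE pk).
Qed.

(** Where [p k = 1] the conjugate is infinite and |v| <= 1 suffices. Elsewhere this is Young's
    inequality with its factors 1 / p k and 1 / p' k, both at most 1, dropped. *)
Lemma young k (u v : R) : (p' k = +oo%E -> `|v| <= 1) ->
  `|u * v| <= `|u| `^ p k + (if p' k != +oo%E then `|v| `^ fine (p' k) else 0).
Proof.
have pk0 := fexpo_gt0 p k.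
move=> v1; rewrite normrM; have [pk|pk] := eqVneq (p k) 1.
  rewrite dual_exponent1//= pk powRr1// addr0 ler_piMr// v1//.
  exact: dual_exponent1.
have [r [E r0 pr]] := dual_exponent_neq1 pk; rewrite E /=.
rewrite (le_trans (conjugate_powR _ _ pk0 r0 pr))//.
rewrite lerD// ler_piMr ?powR_ge0// -pr ?lerDl ?lerDr invr_ge0 ltW//.
Qed.

(** Young's inequality is summed for [x k / l] and [y k / m]; each modular contributes at most 1,
    whence the factor 2. *)
Lemma hoelder_sum (x : nat -> R) (y : nat -> R) l m n :
  lux_ball (extended_exponent p) x l -> lux_ball p' y m ->
  \sum_(0 <= k < n) `|x k * y k| <= 2 * (l * m).
Proof.
move=> [l0 xl] [m0 ym]; rewrite -ler_pdivrMr ?mulr_gt0//.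
rewrite mulr_suml -lee_fin.
have y1 k : p' k = +oo%E -> `|y k / m| <= 1 by move=> _; exact: le1_modular ym.
rewrite [leRHS](_ : _ = 1 + 1)%E; last by rewrite -EFinD.
apply: le_trans (leeD xl ym); rewrite -sumEFin.
apply: (@le_trans _ _ (\sum_(0 <= k < n) (`|x k / l| `^ p k)%:E +
    \sum_(0 <= k < n | p' k != +oo%E) (`|y k / m| `^ fine (p' k))%:E)%E).
  rewrite [X in (_ <= _ + X)%E]big_mkcond -big_split/=; apply: lee_sum => k _.
  have := young (x k / l) (y1 k).
  rewrite mulrACA -invfM normrM [X in _ * X]gtr0_norm ?invr_gt0 ?mulr_gt0//.
  by rewrite -lee_fin EFinD; case: ifP.
rewrite modular_finite; apply: leeD.
  by apply: nneseries_lim_ge => k _ _; rewrite lee_fin powR_ge0.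
rewrite -[leLHS]adde0; apply: leeD.
  by apply: nneseries_lim_ge => k _ _; rewrite lee_fin powR_ge0.
(* The supremum in the modular is at least the adjoined 0. *)
by apply: ereal_sup_ubound; left.
Qed.

Definition pairing (y x : nat -> R) : R := limn (series (fun k => x k * y k)).

Lemma is_cvg_normed_pairing x y : cvgn [normed series (fun k => x k * y k)].
Proof.
apply: nondecreasing_is_cvgn.
  by apply: (@nondecreasing_series _ (fun k => `|x k * y k|) xpredT).
exists (2 * ((`|x| + 1) * (`|y| + 1))) => _ [n _ <-].
by apply: hoelder_sum; apply: lux_ball_norm_lt; rewrite ltrDl.
Qed.

Lemma is_cvg_pairing x y : cvgn (series (fun k => x k * y k)).
Proof. exact/normed_cvg/is_cvg_normed_pairing. Qed.

Lemma pairing_bound x y l m :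
  lux_ball (extended_exponent p) x l -> lux_ball p' y m ->
  `|pairing y x| <= 2 * (l * m).
Proof.
move=> xl ym; apply: le_trans (lim_series_norm _) _.
  exact: is_cvg_normed_pairing.
apply: limr_le; first exact: is_cvg_normed_pairing.
by apply: nearW => n; exact: hoelder_sum.
Qed.

Lemma pairing_linear y : linear (pairing y : lp p -> R).
Proof.
move=> a x z.
rewrite /pairing.
rewrite (_ : (fun _ => _) = a *: (fun k => x k * y k) + (fun k => z k * y k)).
  have cy := @is_cvg_pairing x y; have cz := @is_cvg_pairing z y.
  by rewrite (lim_seriesD (is_cvg_seriesZ (k := a) cy) cz) (lim_seriesZ a cy).
by apply/funext => k; rewrite lq_val_lin mulrDl -mulrA.
Qed.

Lemma pairing_linearl a y z x :
  pairing (a *: y + z : lq p') x = a * pairing y x + pairing z x.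
Proof.
rewrite /pairing.
rewrite (_ : (fun _ => _) = a *: (fun k => x k * y k) + (fun k => x k * z k)).
  have cy := @is_cvg_pairing x y; have cz := @is_cvg_pairing x z.
  by rewrite (lim_seriesD (is_cvg_seriesZ (k := a) cy) cz) (lim_seriesZ a cy).
by apply/funext => k; rewrite lq_val_lin mulrDr mulrCA.
Qed.

Lemma pairing_unit y k : pairing y (unit_seq p k) = y k.
Proof.
rewrite /pairing; under eq_fun do rewrite unit_seqE.
apply: lim_near_cst => //; exists k.+1 => // n /= kn.
rewrite seriesEnat/= (bigD1_seq k) ?mem_index_iota ?iota_uniq//=.
by rewrite eqxx mul1r big1 ?addr0// => i /negbTE ->; rewrite mul0r.
Qed.

Lemma pairing_functional_bound y m : lux_ball p' y m ->
  functional_bound (pairing y : lp p -> R) (2 * m).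
Proof.
move=> ym; have m0 : 0 < m by case: ym.
split=> [|x]; first by rewrite mulr_gt0.
(* The slack [e / (2 * m)] in the radius of [x] becomes [e] after multiplication by [2 * m]. *)
apply/ler_addgt0Pr => e e0; have em : 0 < e / (2 * m).
  by rewrite divr_gt0// mulr_gt0.
rewrite (le_trans (pairing_bound (l := `|x| + e / (2 * m)) _ ym))//.
  by apply: lux_ball_norm_lt; rewrite ltrDl.
rewrite mulrCA mulrDl mulrC divfK ?lt0r_neq0 ?mulr_gt0//.
Qed.

End duality.

(** * The coefficients of a functional form a dual sequence *)

Section coefficients.
Context {R : realType} (p : finite_exponent R).
Local Notation rho := (modular (extended_exponent p)).
Local Notation p' := (dual_exponent (extended_exponent p)).

Lemma modular_lp_prefix (a : nat -> R) n :
  rho (lp_prefix p a n) = (\sum_(0 <= k < n) `|a k| `^ p k)%:E.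
Proof.
rewrite modular_finite (nneseries_split 0 n)// add0n eseries0 ?adde0.
  rewrite -sumEFin; apply: eq_big_nat => k /andP[_ kn].
  by rewrite lp_prefixE kn.
move=> k nk _; rewrite lp_prefixE ltnNge nk normr0 powR0//.
by rewrite gt_eqF// fexpo_gt0.
Qed.

(** For t >= 1, convexity bounds the modular of x / t by that of x divided by t; here t = max(1,
    s). *)
Lemma lq_norm_max1 (q : exponent R) (x : lq q) (s : R) :
  (modular q x <= s%:E)%E -> `|x| <= Num.max 1 s.
Proof.
move=> xs; have m1 : 1 <= Num.max 1 s by rewrite le_max lexx.
have m0 : 0 < Num.max 1 s by exact: lt_le_trans m1.
apply: lq_norm_le; split => //.
rewrite (le_trans (@modular_scale _ q x _ (Num.max 1 s)^-1 _ _))//.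
- by rewrite invr_ge0 ltW//= invf_le1.
- by move=> k; rewrite normrM mulrC normfV (gtr0_norm m0).
rewrite (@le_trans _ _ ((Num.max 1 s)^-1%:E * s%:E)%E)//.
  by rewrite lee_wpmul2l// lee_fin invr_ge0 ltW.
by rewrite -EFinM lee_fin mulrC ler_pdivrMr// mul1r le_max lexx orbT.
Qed.

Lemma unit_seq_norm_le1 k : `|unit_seq p k| <= 1.
Proof.
rewrite -[leRHS](maxxx 1); apply: lq_norm_max1.
rewrite modular_finite; under eq_eseriesr do rewrite unit_seqE.
rewrite (nneseriesD1 (n := k))// eqxx normr1 powR1.
rewrite eseries0 ?adde0// => i _ /= /negbTE ->.
by rewrite normr0 powR0// gt_eqF// fexpo_gt0.
Qed.

(** [b] is the extremal choice in Hölder's inequality: the conjugate r of [p k] satisfies (r - 1) p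
    k = r. *)
Lemma dual_power k (z : R) : p' k != +oo%E ->
  let b := Num.sg z * `|z| `^ (fine (p' k) - 1) in
  `|b| `^ p k = `|z| `^ fine (p' k) /\ b * z = `|z| `^ fine (p' k).
Proof.
have pk0 := fexpo_gt0 p k.
have [/dual_exponent1 -> //|pk] := eqVneq (p k) 1.
have [r [-> r0 pr]] := dual_exponent_neq1 pk => _ /=.
have rp : (r - 1) * p k = r.
  have : p k * r * ((p k)^-1 + r^-1) = p k * r by rewrite pr mulr1.
  rewrite mulrDr mulrAC divff ?gt_eqF// mul1r -mulrA divff ?gt_eqF//.
  by lra.
have [->|z0] := eqVneq z 0.
  by rewrite sgr0 mul0r mulr0 normr0 !powR0// gt_eqF.
rewrite normrM normr_sg z0 mul1r ger0_norm ?powR_ge0//; split.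
  by rewrite -powRrM rp.
by rewrite mulrAC -normrEsg mulr_powRB1.
Qed.

(* With z k = f e_k / (2c) and S a partial sum of |z k|^(p' k), testing f on
   x k = sgn (z k) |z k|^(p' k - 1), whose modular is S, gives
   2 c S = f x <= c max(1, S), hence S <= 1/2; the indices with p k = 1
   contribute a supremum which is also at most 1/2. *)
Lemma coef_lux_ball (f : dual (lp p)) c : functional_bound f c ->
  lux_ball p' (fun k => f (unit_seq p k)) (2 * c).
Proof.
move=> [c0 fc]; have c20 : 0 < 2 * c by rewrite mulr_gt0.
split=> //; set z := fun k => f (unit_seq p k) / (2 * c).
have half : (1 = (2^-1)%:E + (2^-1)%:E :> \bar R)%E.
  by rewrite -EFinD; congr EFin; lra.
rewrite half; apply: leeD; last first.
  apply: ge_ereal_sup => _ [->|[k _ <-]]; rewrite lee_fin.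
    by rewrite invr_ge0.
  rewrite normrM normfV (gtr0_norm c20) ler_pdivrMr// mulKf//.
  by rewrite (le_trans (fc _))// ler_piMr ?unit_seq_norm_le1// ltW.
apply: nneseries_le => [k _|n]; first by rewrite lee_fin powR_ge0.
pose b k := if p' k != +oo%E then
  Num.sg (z k) * `|z k| `^ (fine (p' k) - 1) else 0.
pose S := \sum_(0 <= k < n) `|b k| `^ p k.
have SE : S = \sum_(0 <= k < n | p' k != +oo%E) `|z k| `^ fine (p' k).
  rewrite [RHS]big_mkcond; apply: eq_bigr => k _; rewrite /b.
  case: ifP => [/(dual_power (z k))[]//|_].
  by rewrite normr0 powR0// gt_eqF// fexpo_gt0.
have fS : f (lp_prefix p b n) = 2 * c * S.
  rewrite linear_sum SE [in RHS]big_mkcond mulr_sumr; apply: eq_bigr => k _.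
  rewrite linearZ /=; have -> : f (unit_seq p k) = 2 * c * z k.
    by rewrite mulrC divfK// gt_eqF.
  rewrite mulrCA /b; case: ifP => [/(dual_power (z k))[_ ->]//|_].
  by rewrite mul0r.
have xS : `|lp_prefix p b n| <= Num.max 1 S.
  by apply: lq_norm_max1; rewrite modular_lp_prefix.
rewrite sumEFin lee_fin -SE.
have : 2 * c * S <= c * Num.max 1 S.
  by rewrite -fS (le_trans (ler_norm _))// (le_trans (fc _))// ler_pM2l.
rewrite [2 * c]mulrC -mulrA ler_pM2l// le_max => /orP[|]; lra.
Qed.

End coefficients.

(** * The germ norm and functionals vanishing on unit sequences *)

Section germ.
Context {R : realType} (p : finite_exponent R).
Local Notation rho := (modular (extended_exponent p)).
Implicit Types (x y : lp p) (f : dual (lp p)).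

(* f ignores any initial segment of x, and a far tail of x / l has modular at
   most 1. *)
Lemma singular_functional_bound f c x l : functional_bound f c ->
    (forall k, f (unit_seq p k) = 0) -> 0 < l ->
  (rho (fun k => (x k / l)%R) < +oo)%E -> `|f x| <= c * l.
Proof.
move=> [c0 fc] f0 l0 /modular_tail[n xn].
have -> : f x = f (x - lp_prefix p x n).
  rewrite linearB /= [X in _ - X]linear_sum big1 ?subr0// => k _.
  by rewrite linearZ /= f0 mulr0.
rewrite (le_trans (fc _))// ler_pM2l//; apply: lq_norm_le; split=> //.
apply: le_trans xn; apply: modular_le => k.
rewrite lq_valB lp_prefixE.
by case: ifP; rewrite ?subrr ?subr0 ?mul0r.
Qed.

Lemma lp_b0 : (lp_b p) 0.
Proof. by exists 0 => k /eqP. Qed.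

(* For z in lp_b, x / l and (x - z) / l differ only where p is bounded, and
   there every rescaling of x has finite modular. *)
Lemma germ_norm_lt x l : germ_norm x < l ->
  (rho (fun k => (x k / l)%R) < +oo)%E.
Proof.
move=> /inf_lt[|_ [y yb <-] yl].
  by exists `|x - 0|, 0 => //; exact/subset_closure/lp_b0.
(* The point [y] of the closure is replaced by a point [z] of [lp_b] so near that |x - z| is still
   below [l]. *)
have [z [[M zM] yz]] : exists z, (lp_b p) z /\ `|y - z| < l - `|x - y|.
  have [|z [zb yz]] := yb (ball y (l - `|x - y|)).
    by apply: nbhsx_ballx; rewrite subr_gt0.
  by exists z; split => //; move: yz; rewrite -ball_normE.
have [l0 xz1] : lux_ball (extended_exponent p) (x - z) l.
  apply: lux_ball_norm_lt; apply: le_lt_trans (ler_distD y _ _) _.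
  by rewrite addrC -ltrBrDr.
have /asboolP[m m0 xm] := lqP x.
(* Where [z k] is nonzero, p k <= M and so (m / l)^(p k) <= a^(p k) <= a^M, the last step using 1 <=
   a. Elsewhere [x] and [x - z] agree. *)
pose a := Num.max 1 (m / l).
have a1 : 1 <= a by rewrite le_max lexx.
have mla : m / l <= a by rewrite le_max lexx orbT.
apply: (@le_lt_trans _ _ (rho (fun k => ((x - z : lp p) k / l)%R) +
    (a `^ M)%:E * rho (fun k => (x k / m)%R))%E); last first.
  rewrite lte_add_pinfty ?(le_lt_trans xz1) ?ltry//.
  by rewrite lte_mul_pinfty ?lee_fin ?powR_ge0.
rewrite !modular_finite -nneseriesZl; last by move=> k _; rewrite lee_fin powR_ge0.
rewrite -nneseriesD; last 2 first.
- by move=> k _ _; rewrite lee_fin powR_ge0.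
- by move=> k _ _; rewrite -EFinM lee_fin mulr_ge0 ?powR_ge0.
apply: lee_nneseries => [k _ _|k _]; first by rewrite lee_fin powR_ge0.
rewrite -EFinM -EFinD lee_fin.
rewrite lq_valB.
have [->|zk] := eqVneq (z k) 0.
  by rewrite subr0 lerDl mulr_ge0 ?powR_ge0.
have -> : x k / l = m / l * (x k / m).
  by field; rewrite !gt_eqF.
have ml0 : 0 <= m / l by rewrite divr_ge0// ltW.
rewrite normrM (ger0_norm ml0) powRM// -[leLHS]add0r lerD ?powR_ge0//.
rewrite ler_wpM2r ?powR_ge0// (@le_trans _ _ (a `^ p k))//.
  apply: ge0_ler_powR; rewrite ?nnegrE//; first exact/ltW/fexpo_gt0.
  exact: le_trans a1.
by rewrite ler_powR// zM.
Qed.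

Lemma omega_le_norm (A : content_set p) : omega A <= `|lp_indic A|.
Proof.
apply: ge_inf; first by exists 0 => _ [y _ <-].
by exists 0; rewrite ?subr0//; exact/subset_closure/lp_b0.
Qed.

(** [p] is bounded on a singleton. Hence set functions of bounded variation vanish on singletons,
    and the functionals built from them have zero coefficients. *)
Lemma omega_content1 k : omega (content1 p k) = 0.
Proof.
apply/le_anti; rewrite omega_ge0 andbT.
apply: ge_inf; first by exists 0 => _ [y _ <-].
exists (unit_seq p k); last by rewrite subrr normr0.
apply: subset_closure; exists (p k) => i.
by rewrite unit_seqE; case: (eqVneq i k) => [->|_ /eqP].
Qed.

Lemma simple_seqE N (a : 'I_N -> R) (A : 'I_N -> content_set p) i k :
  trivIset setT (fun i => A i : set nat) -> (A i : set nat) k ->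
  (\sum_(j < N) a j *: lp_indic (A j)) k = a i.
Proof.
move=> tA Aik; rewrite lq_val_sum.
under eq_bigr do rewrite lq_valZ lp_indicE.
rewrite (bigD1 i)//= mem_set// mulr1 big1 ?addr0// => j ji.
rewrite memNset ?mulr0// => Ajk; move/eqP: ji; apply.
by apply: tA => //; exists k.
Qed.

(* Test f on the sum of the sgn(f 1_(A i)) / omega (A i) *: 1_(A i): by
   disjointness its germ norm is at most 1. *)
Lemma variation_bound_singular f c : functional_bound f c ->
    (forall k, f (unit_seq p k) = 0) ->
  variation_bound (fun A : content_set p => f (lp_indic A)) c.
Proof.
move=> fc f0; have c0 : 0 < c by case: fc.
(* Without this the extended quotient could be infinite; with it, the variation becomes a sum of
   real numbers. *)
have f_omega (A : content_set p) : omega A = 0 -> f (lp_indic A) = 0.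
  move=> A0; apply/eqP; rewrite -normr_le0; apply/ler_addgt0Pr => e e0.
  rewrite add0r -(divfK (lt0r_neq0 c0) e) mulrC.
  have ec0 : 0 < e / c by rewrite divr_gt0.
  apply: singular_functional_bound => //.
  by apply: germ_norm_lt; rewrite -/(omega A) A0.
split=> // n A tA.
under eq_bigr => i _.
  rewrite EFin_div; last by move=> /f_omega ->; rewrite normr0.
  over.
rewrite sumEFin lee_fin; apply/ler_addgt0Pr => e e0.
pose a i := Num.sg (f (lp_indic (A i))) / omega (A i).
pose x : lp p := \sum_(i < n) a i *: lp_indic (A i).
have -> : \sum_(i < n) `|f (lp_indic (A i))| / omega (A i) = f x.
  rewrite linear_sum; apply: eq_bigr => i _; rewrite linearZ /=.
  by rewrite normrEsg mulrAC.
(* [germ_norm_lt] needs a radius strictly above the germ norm; this enlargement of 1 gives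
   [c * l = c + e]. *)
pose l := 1 + e / c.
have ec0 : 0 < e / c by rewrite divr_gt0.
have l1 : 1 < l by rewrite ltrDl.
have l0 : 0 < l by exact: lt_trans l1.
have -> : c + e = c * l by rewrite mulrDr mulr1 mulrC divfK// gt_eqF.
rewrite (le_trans (ler_norm _))// (singular_functional_bound fc)//.
(* At each [k] at most one term of [x] is nonzero, so the modular of x / l is at most the sum of the
   modulars of the terms. *)
apply: (@le_lt_trans _ _
    (\sum_(i < n) rho (fun k => ((a i *: lp_indic (A i) : lp p) k / l)%R))%E).
  rewrite modular_finite; under [leRHS]eq_bigr do rewrite modular_finite.
  rewrite -nneseries_sum; last by move=> i k _; rewrite lee_fin powR_ge0.
  apply: lee_nneseries => [k _ _|k _]; first by rewrite lee_fin powR_ge0.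
  rewrite sumEFin lee_fin.
  have [[i Aik]|nA] := pselect (exists i, (A i : set nat) k).
    rewrite (simple_seqE a tA Aik).
    have -> : a i = (a i *: lp_indic (A i) : lp p) k.
      by rewrite lq_valZ lp_indicE mem_set// mulr1.
    by rewrite (bigD1 i)// lerDl sumr_ge0// => j _; rewrite powR_ge0.
  rewrite lq_val_sum big1 ?mul0r ?normr0 ?powR0 ?gt_eqF ?fexpo_gt0//.
    by rewrite sumr_ge0// => j _; rewrite powR_ge0.
  move=> i _; rewrite lq_valZ.
  by rewrite lp_indicE memNset ?mulr0// => Aik; apply: nA; exists i.
apply: lte_sum_pinfty => i _.
(* If [omega (A i) = 0], then [a i = 0] because the inverse of 0 in [R] is 0. Otherwise
   [omega (A i) * l] strictly exceeds the germ norm. *)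
have [A0|A0] := eqVneq (omega (A i)) 0.
  rewrite (_ : (fun _ => _) = 0) ?modular0// funeqE => k.
  rewrite lq_valZ.
  by rewrite /a A0 invr0 mulr0 !mul0r.
have oA : omega (A i) < omega (A i) * l.
  by rewrite ltr_pMr// lt_neqAle eq_sym A0 omega_ge0.
apply: le_lt_trans (germ_norm_lt oA); apply: modular_le => k.
rewrite lq_valZ.
rewrite /a invfM !normrM normr_sg [leRHS]mulrA; apply: ler_wpM2r => //.
rewrite [leLHS]mulrC; apply: ler_wpM2l => //.
by rewrite ler_piMl// lern1 leq_b1.
Qed.

End germ.

(** * Functionals built from set functions *)

Lemma lq_norm_mono {R : realType} (q : exponent R) (x y : lq q) :
  (forall k, `|x k| <= `|y k|) -> `|x| <= `|y|.
Proof.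
move=> xy; apply/ler_addgt0Pr => e e0.
have [l0 yl] : lux_ball q y (`|y| + e) by apply: lux_ball_norm_lt; rewrite ltrDl.
apply: lq_norm_le; split=> //; apply: le_trans yl; apply: modular_le => k.
by rewrite !normrM ler_wpM2r.
Qed.

Section set_functions.
Context {R : realType} {p : finite_exponent R}.
Implicit Types (A B : content_set p) (mu : content_set p -> R).

(** Set functions take a set together with its proof of finite content; this makes the value
    independent of the proof. *)
Lemma content_set_inj A B : A = B :> set nat -> A = B.
Proof.
by case: A B => [A cA] [B cB] /= AB; case: _ / AB cB => cB; congr ContentSet.
Qed.

Lemma sub_finite_content A (B : set nat) : B `<=` A -> finite_content p B.
Proof.
move=> BA; have [b b1 Ab] := contentP A; exists b => //.
apply: le_lt_trans Ab; rewrite eseries_mkcond [leRHS]eseries_mkcond.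
apply: lee_nneseries => k _; first by case: ifP => // _; rewrite lee_fin powR_ge0.
case: ifPn => [/set_mem/BA kA|_]; first by rewrite mem_set.
by case: ifP => // _; rewrite lee_fin powR_ge0.
Qed.

Lemma finitely_additive_bigcup mu (I : eqType) (r : seq I)
    (F : I -> content_set p) A :
  finitely_additive mu -> uniq r -> trivIset setT (fun i => F i : set nat) ->
  (forall k, (A : set nat) k <-> exists2 i, i \in r & (F i : set nat) k) ->
  mu A = \sum_(i <- r) mu (F i).
Proof.
move=> muD + tF; elim: r A => [|i r IHr] A /=.
  move=> _ A0; have {}A0 : (A : set nat) = set0.
    by apply/seteqP; split => // k /A0[].
  (* The empty set is the disjoint union of itself with itself, so [mu] vanishes on it. *)
  rewrite big_nil; have AA : A = contentU A A.
    by apply: content_set_inj; rewrite /= setUid.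
  apply: (addrI (mu A)); rewrite addr0 -[RHS]/(mu A) {3}AA muD// A0 setI0//.
move=> /andP[ir ur] AE; rewrite big_cons.
have sub : [set k | exists2 j, j \in r & (F j : set nat) k] `<=` A.
  by move=> k [j jr Fjk]; apply/AE; exists j => //; rewrite inE jr orbT.
pose B := ContentSet (sub_finite_content sub).
have -> : A = contentU (F i) B.
  apply: content_set_inj; apply/seteqP; split => k /=.
    move=> /AE[j]; rewrite inE => /predU1P[->|jr] Fjk; first by left.
    by right; exists j.
  move=> [Fik|[j jr Fjk]]; apply/AE; first by exists i => //; exact: mem_head.
  by exists j => //; rewrite inE jr orbT.
rewrite muD; first by rewrite (IHr B).
apply/seteqP; split => // k [Fik [j jr Fjk]].
by move: ir; rewrite (tF i j) ?jr//; exists k.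
Qed.

(** A one-member family suffices: a nonzero value over 0 would be an infinite quotient. *)
Lemma variation_bound_omega0 mu c A : variation_bound mu c ->
  omega A = 0 -> mu A = 0.
Proof.
move=> [c0 /(_ 1%N (fun=> A))]; rewrite big_ord1 => muA A0.
have /muA : trivIset setT (fun i : 'I_1 => A : set nat).
  by move=> i j _ _ _; rewrite (ord1 i) (ord1 j).
rewrite A0 inve0; have [//|m0] := eqVneq (mu A) 0.
by rewrite gt0_muley ?lte_fin ?normr_gt0// leye_eq.
Qed.

(** A real-valued form for arbitrary finite index types, because the atoms below are indexed by
    boolean functions. *)
Lemma variation_bound_fin mu c (I : finType) (A : I -> content_set p) :
  variation_bound mu c -> trivIset setT (fun i => A i : set nat) ->
  \sum_i `|mu (A i)| / omega (A i) <= c.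
Proof.
move=> muc tA.
have tA' : trivIset setT (fun i : 'I_#|I| => A (enum_val i) : set nat).
  by move=> i j _ _ Aij; apply/enum_val_inj/tA.
have [_ /(_ _ _ tA')] := muc.
under eq_bigr => i _.
  rewrite EFin_div; last by move=> /(variation_bound_omega0 muc) ->; rewrite normr0.
  over.
rewrite sumEFin lee_fin; apply: le_trans.
by rewrite -(big_enum_val (fun i => `|mu (A i)| / omega (A i))) /=.
Qed.

(* The sets in s need not be disjoint, which makes linearity immediate;
   single-valuedness will come out of the norm bound. *)
Definition simple_relation mu (x : lp p) (c : R) : Prop :=
  exists s : seq (R * content_set p),
    x = \sum_(w <- s) w.1 *: lp_indic w.2 /\ c = \sum_(w <- s) w.1 * mu w.2.

Lemma simple_relation_lin mu a x y c d :
  simple_relation mu x c -> simple_relation mu y d ->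
  simple_relation mu (a *: x + y) (a * c + d).
Proof.
move=> [s [-> ->]] [t [-> ->]].
exists ([seq (a * w.1, w.2) | w <- s] ++ t); rewrite !big_cat !big_map/=.
split; congr (_ + _).
  by rewrite scaler_sumr; apply: eq_bigr => w _; rewrite scalerA.
by rewrite mulr_sumr; apply: eq_bigr => w _; rewrite mulrA.
Qed.

(** On each disjoint atom [B J], [x] has a constant value [b J], so |b J| omega (B J) <= |x| by
    monotonicity of the norm. As [d] is the sum of the [b J * mu (B J)], it is at most |x| times the
    variation sum over the atoms. *)
Lemma simple_relation_bound mu c x d : finitely_additive mu ->
  variation_bound mu c -> simple_relation mu x d -> `|d| <= c * `|x|.
Proof.
move=> muD muc [s [xE ->]].
pose N := size s; pose w0 : R * content_set p := (0, content1 p 0).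
pose a (i : 'I_N) := (nth w0 s i).1; pose A (i : 'I_N) := (nth w0 s i).2.
(* The atoms of the algebra generated by the A i, with the outer one left out. *)
pose atom (J : {ffun 'I_N -> bool}) :=
  [set k | [ffun i => k \in (A i : set nat)] = J /\ exists i, J i].
have atomP J : finite_content p (atom J).
  have [[i Ji]|J0] := pselect (exists i, J i).
    apply: (@sub_finite_content (A i)) => k [/ffunP/(_ i)].
    by rewrite ffunE Ji => /set_mem.
  (* For [J] identically false the atom is empty, and any set of finite content contains it. *)
  by apply: (@sub_finite_content (content1 p 0)) => k [].
pose B J := ContentSet (atomP J).
have tB : trivIset setT (fun J => B J : set nat).
  by move=> J K _ _ [k [[<- _] [<- _]]].
have muA i : mu (A i) = \sum_(J : {ffun 'I_N -> bool} | J i) mu (B J).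
  rewrite -big_filter; apply: finitely_additive_bigcup => //.
    by rewrite filter_uniq// index_enum_uniq.
  move=> k; split => [Aik|[J]]; last first.
    rewrite mem_filter => /andP[Ji _] [/ffunP/(_ i)].
    by rewrite ffunE Ji => /set_mem.
  exists [ffun i => k \in (A i : set nat)].
    by rewrite mem_filter mem_index_enum ffunE mem_set.
  by split => //; exists i; rewrite ffunE mem_set.
pose b (J : {ffun 'I_N -> bool}) := \sum_(i | J i) a i.
have -> : \sum_(w <- s) w.1 * mu w.2 = \sum_J b J * mu (B J).
  rewrite (big_nth w0) big_mkord.
  under eq_bigr => i _ do rewrite -/(A i) -/(a i) muA mulr_sumr.
  rewrite (exchange_big_dep xpredT)//=; apply: eq_bigr => J _.
  by rewrite mulr_suml.
have xB J k : atom J k -> x k = b J.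
  move=> [/ffunP Jk _]; rewrite xE lq_val_sum (big_nth w0) big_mkord.
  rewrite /b [RHS]big_mkcond; apply: eq_bigr => i _.
  rewrite lq_valZ lp_indicE -/(A i) -/(a i) -Jk ffunE.
  by case: (k \in _); rewrite ?mulr1 ?mulr0.
have bx J : `|b J| * omega (B J) <= `|x|.
  rewrite (le_trans (ler_wpM2l _ (omega_le_norm (B J))))// -normrZ.
  apply: lq_norm_mono => k; rewrite lq_valZ lp_indicE.
  have [kJ|kJ] := boolP (k \in (B J : set nat)); last by rewrite mulr0 normr0.
  by rewrite mulr1 (@xB J)//; exact: set_mem.
rewrite (le_trans (ler_norm_sum _ _ _))//.
apply: (@le_trans _ _ (`|x| * \sum_J `|mu (B J)| / omega (B J))); last first.
  by rewrite mulrC ler_wpM2r// variation_bound_fin.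
rewrite mulr_sumr; apply: ler_sum => J _; rewrite normrM.
(* Dividing by [omega (B J)] needs it nonzero; otherwise [mu (B J)] is 0 as well. *)
have [B0|B0] := eqVneq (omega (B J)) 0.
  by rewrite (variation_bound_omega0 muc B0) normr0 mulr0 mul0r mulr0.
rewrite -[leLHS](mulfK B0) mulrA -(mulrAC _ (omega _)) ler_wpM2r//.
  by rewrite invr_ge0 omega_ge0.
by rewrite ler_wpM2r// bx.
Qed.

Lemma simple_extension mu c : dense (simple_sequences p) ->
  finitely_additive mu -> variation_bound mu c ->
  exists F : lp p -> R, [/\ linear F, functional_bound F c &
    forall A, F (lp_indic A) = mu A].
Proof.
move=> dS muD muc; have c0 : 0 < c by case: muc.
have [|||F [F_lin Fc F_mu]] :=
  @dense_linear_extension _ _ (simple_relation mu) c (ltW c0).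
- exact: simple_relation_lin.
- by move=> x d; exact: simple_relation_bound.
- move=> O O0 oO; have [x [Ox [N [a [A [_ xE]]]]]] := dS O O0 oO.
  exists x; split=> //; exists (\sum_(i < N) a i * mu (A i)).
  exists [seq (a i, A i) | i <- index_enum _].
  by rewrite xE !big_map.
exists F; split=> // A; apply: F_mu.
by exists [:: (1, A)]; rewrite !big_seq1 scale1r mul1r.
Qed.

End set_functions.

(** * The decomposition map and its inverse *)

Section representation.
Context {R : realType} {p : finite_exponent R}.
Local Notation p' := (dual_exponent (extended_exponent p)).
Implicit Types (f : dual (lp p)) (y : lq p').

Lemma coef_in_lq f : (fun k => f (unit_seq p k)) \in in_lq p'.
Proof.
have /asboolP[_ [c /coef_lux_ball[c0 fc]]] := dualP f.
by apply/asboolP; exists (2 * c) => //; rewrite (le_lt_trans fc)// ltry.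
Qed.

Definition regular_part f : lq p' := Lq (coef_in_lq f).

Lemma pairing_bounded y : (pairing y : lp p -> R) \in bounded_functional (V := lp p).
Proof.
apply/asboolP; split; first exact: pairing_linear.
exists (2 * (`|y| + 1)); apply: pairing_functional_bound.
by apply: lux_ball_norm_lt; rewrite ltrDl.
Qed.

Definition pairing_dual y : dual (lp p) := Dual (pairing_bounded y).

Definition singular_part f : dual (lp p) := f - pairing_dual (regular_part f).

Lemma singular_partE f x : singular_part f x = f x - pairing (regular_part f) x.
Proof. by []. Qed.

Lemma singular_part_unit f k : singular_part f (unit_seq p k) = 0.
Proof. by rewrite singular_partE pairing_unit subrr. Qed.

(** The constant is 1 + 4: the coefficients lie in the ball of radius [2 * c], and the pairing
    doubles it. *)
Lemma singular_part_bound f c :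
  functional_bound f c -> functional_bound (singular_part f) (5 * c).
Proof.
move=> fc; have [c0 fcx] := fc.
have [_ yc] := pairing_functional_bound (y := regular_part f) (coef_lux_ball fc).
split=> [|x]; first by rewrite mulr_gt0.
rewrite singular_partE (le_trans (ler_normB _ _))//.
by have := fcx x; have := yc x; lra.
Qed.

Lemma singular_measure_in_pba f :
  (fun A => singular_part f (lp_indic A)) \in in_pba (p := p).
Proof.
apply/asboolP; split.
  move=> A B AB; rewrite -linearD; apply: (congr1 (singular_part f)).
  apply/val_inj/funext => k /=.
  rewrite -[RHS]/(\1_(A : set nat) k + \1_(B : set nat) k) !indicE in_setU.
  have [kA|kA] := boolP (k \in (A : set nat)); last by rewrite add0r.
  rewrite memNset ?addr0// => kB; rewrite -[False]/(set0 k) -AB.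
  by split=> //; exact: set_mem.
have /asboolP[_ [c /singular_part_bound fc]] := dualP f.
by exists (5 * c); apply: variation_bound_singular fc (singular_part_unit f).
Qed.

Definition singular_measure f : pba p := Pba (singular_measure_in_pba f).

Definition decompose f : lq p' * pba p := (regular_part f, singular_measure f).

Lemma decompose_linear : linear decompose.
Proof.
move=> a f g; have yE : regular_part (a *: f + g) =
    a *: regular_part f + regular_part g by exact/val_inj.
congr pair; first exact: yE.
apply/val_inj/funext => A.
rewrite -[LHS]/(singular_part (a *: f + g) (lp_indic A)).
rewrite -[RHS]/(a * singular_part f (lp_indic A) +
  singular_part g (lp_indic A)) !singular_partE yE pairing_linearl.
rewrite -[(a *: f + g : dual _) _]/(a * f (lp_indic A) + g (lp_indic A)).
by ring.
Qed.

HB.instance Definition _ := GRing.isLinear.Build R (dual (lp p))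
  (lq p' * pba p)%type *:%R decompose decompose_linear.

(** The product carries the maximum norm; the components are bounded by 2 |f| and 5 |f|. *)
Lemma decompose_norm_le f : `|decompose f| <= 5 * `|f|.
Proof.
apply/ler_addgt0Pr => e e0.
have e50 : 0 < e / 5 by rewrite divr_gt0.
have fc : functional_bound f (`|f| + e / 5).
  by apply: functional_bound_norm_lt; rewrite ltrDl.
have f0 := normr_ge0 f.
rewrite prod_normE ge_max; apply/andP; split.
  have := lq_norm_le (x := regular_part f) (coef_lux_ball fc).
  by move=> /le_trans; apply; lra.
have := pba_norm_le (mu := singular_measure f)
  (variation_bound_singular (singular_part_bound fc) (singular_part_unit f)).
by move=> /le_trans; apply; lra.
Qed.

Hypothesis dS : dense (simple_sequences p).

(** By linearity [f] vanishes on simple sequences, and by continuity on the closure of these. *)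
Lemma dense_eq0 f : (forall A, f (lp_indic A) = 0) -> f = 0.
Proof.
move=> f0; apply/val_inj/funext => x.
rewrite -[LHS]/(f x) -[RHS]/(0 : R); apply/eqP; rewrite -normr_le0.
have /asboolP[_ [c [c0 fc]]] := dualP f.
apply/ler_addgt0Pr => e e0; rewrite add0r.
have [||z [xz [N [a [A [_ zE]]]]]] := dS (O := ball x (e / c)).
- by exists x; apply: ballxx; rewrite divr_gt0.
- exact: ball_open.
rewrite -ball_normE /= in xz.
have -> : f x = f (x - z).
  rewrite linearB zE [X in _ - X]linear_sum big1 ?subr0// => i _.
  by rewrite linearZ /= f0 mulr0.
by rewrite (le_trans (fc _))// mulrC -ler_pdivlMr// ltW.
Qed.

Lemma decompose_eq0 f : decompose f = 0 -> f = 0.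
Proof.
move=> f0; have y0 : regular_part f = 0 := congr1 fst f0.
have mu0 : singular_measure f = 0 := congr1 snd f0.
apply: dense_eq0 => A; have : singular_part f (lp_indic A) = 0.
  exact: (congr1 (fun mu : pba p => mu A) mu0).
(* Pairing with the zero sequence gives 0, so [f] equals its singular part. *)
have := pairing_linearl (-1) (0 : lq p') 0 (lp_indic A).
rewrite scaleN1r addNr mulN1r addNr => pairing0.
by rewrite singular_partE y0 pairing0 subr0.
Qed.

Lemma pairing_dual_norm_le y : `|pairing_dual y| <= 2 * `|y|.
Proof.
apply/ler_addgt0Pr => e e0; have e20 : 0 < e / 2 by rewrite divr_gt0.
rewrite -[e](divfK (x := 2))// [_ * 2]mulrC -mulrDr.
apply/dual_norm_le/pairing_functional_bound.
by apply: lux_ball_norm_lt; rewrite ltrDl.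
Qed.

(** The preimage is the pairing with [y] plus the extension [F] of [mu]. [F] vanishes on unit
    sequences, so the coefficients are [y] and the singular part is [F]. Its norm is at most 2 |y| +
    |mu| + e. *)
Lemma decompose_surj w e : 0 < e ->
  exists f, decompose f = w /\ `|f| <= 3 * `|w| + e.
Proof.
case: w => y mu e0.
have /asboolP[muD _] := pbaP mu.
have muc : variation_bound mu (`|mu| + e).
  by apply: variation_bound_norm_lt; rewrite ltrDl.
have [F [F_lin F_bound F_mu]] := simple_extension dS muD muc.
have F_dual : F \in bounded_functional (V := lp p).
  by apply/asboolP; split=> //; exists (`|mu| + e).
exists (pairing_dual y + Dual F_dual).
have yE : regular_part (pairing_dual y + Dual F_dual) = y.
  apply/val_inj/funext => k.
  rewrite -[LHS]/(pairing y (unit_seq p k) + F (unit_seq p k)) pairing_unit.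
  by rewrite F_mu (variation_bound_omega0 muc) ?addr0// omega_content1.
split.
  congr pair; first exact: yE.
  apply/val_inj/funext => A.
  rewrite -[LHS]/(singular_part (pairing_dual y + Dual F_dual) (lp_indic A)).
  rewrite singular_partE yE.
  rewrite -[X in X - _]/(pairing y (lp_indic A) + F (lp_indic A)).
  by rewrite F_mu addrC addKr.
have : `|Dual F_dual : dual (lp p)| <= `|mu| + e by exact: dual_norm_le.
have := pairing_dual_norm_le y.
have := ler_normD (pairing_dual y) (Dual F_dual : dual (lp p)).
have : `|y| <= `|(y, mu)| by rewrite prod_normE le_max lexx.
have : `|mu| <= `|(y, mu)| by rewrite prod_normE le_max lexx orbT.
by lra.
Qed.

(** The tolerance 1 is arbitrary, since injectivity makes the preimage unique. *)
Let recompose w : dual (lp p) := sval (cid (decompose_surj w ltr01)).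

Let recomposeK w : decompose (recompose w) = w.
Proof. by rewrite /recompose; case: cid => f []. Qed.

Let decompose_inj f g : decompose f = decompose g -> f = g.
Proof.
move=> fg; apply/eqP; rewrite -subr_eq0; apply/eqP/decompose_eq0.
by rewrite linearB /= fg subrr.
Qed.

Let recompose_linear : linear recompose.
Proof.
move=> a v w; apply: decompose_inj; by rewrite linearP /= !recomposeK.
Qed.

HB.instance Definition _ := GRing.isLinear.Build R
  (lq p' * pba p)%type (dual (lp p)) *:%R recompose recompose_linear.

Lemma isomorphic_dual : isomorphic (dual (lp p)) (lq p' * pba p)%type.
Proof.
exists decompose, recompose; split=> //.
- by move=> f; apply: decompose_inj; rewrite recomposeK.
- apply/linear_boundedP; exists 5; split=> // r r5 f.
  by rewrite (le_trans (decompose_norm_le f))// ler_wpM2r// ltW.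
- apply/linear_boundedP; exists 3; split=> // r r3 w.
  rewrite (@le_trans _ _ (3 * `|w|))//; last by rewrite ler_wpM2r// ltW.
  (* By injectivity the preimage supplied for each [e] is [recompose w], which thus satisfies the
     bound for every [e]. *)
  apply/ler_addgt0Pr => e /(decompose_surj w)[f [fw]].
  by rewrite -{1}(recomposeK w) in fw; rewrite (decompose_inj fw).
Qed.

End representation.

Theorem theorem3p17 (R : realType) (p : finite_exponent R) :
  dense (simple_sequences p) ->
  isomorphic (dual (lp p))
    (lq (dual_exponent (extended_exponent p)) * pba p)%type.
Proof. exact: isomorphic_dual. Qed.
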